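(* Let $B_i,A_j\in\mathbb{M}_N$ for $1\le i\le m$, $1\le j\le n$ satisfy $(B_1,\ldots,B_m)^T=U(A_1,\ldots,A_n)^T$, i.e. $B_i=\sum_{j=1}^n u_{ij}A_j$ for all $i$, for some $m\times n$ complex isometry $U=(u_{ij})$ (that is, $U^*U=I_n$). Let $|||\cdot|||$ be any unitarily invariant norm on $\mathbb{M}_N$. Then for $p\ge2$, $$m^{1-\frac p2}\,\Bigl|\Bigl|\Bigl|\sum_{j=1}^n|A_j|_{\mathrm{qsym}}^p\Bigr|\Bigr|\Bigr|\le\Bigl|\Bigl|\Bigl|\sum_{i=1}^m|B_i|_{\mathrm{qsym}}^p\Bigr|\Bigr|\Bigr|\le n^{\frac p2-1}\,\Bigl|\Bigl|\Bigl|\sum_{j=1}^n|A_j|_{\mathrm{qsym}}^p\Bigr|\Bigr|\Bigr|.$$ For $0<p\le2$, both inequalities are reversed.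
   Context: $\mathbb{M}_N$ is the space of $N\times N$ complex matrices. A norm $|||\cdot|||$ on $\mathbb{M}_N$ is unitarily invariant if $|||UXV|||=|||X|||$ for all $X$ and all unitaries $U,V$. For $Z\in\mathbb{M}_N$, the quadratic symmetric modulus is $|Z|_{\mathrm{qsym}}=\left(\frac{Z^*Z+ZZ^*}{2}\right)^{1/2}$. *)

(* Defs.v *)
From HB Require Import structures.
From mathcomp Require Import all_boot all_order all_algebra.
From mathcomp Require Import complex.
From mathcomp Require Import reals exp.

Set Implicit Arguments.
Unset Strict Implicit.
Unset Printing Implicit Defensive.

Import Order.TTheory GRing.Theory Num.Theory.

Local Open Scope ring_scope.
Local Open Scope complex_scope.
Local Open Scope sesquilinear_scope.

(* Spectral functional calculus f(H) = V^-1 diag(f(lambda_k)) V, where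
   H = V^-1 diag(lambda_k) V with V unitary is the decomposition given by
   [orthomx_spectralP].  Meaningful for hermitian H only, where the lambda_k
   are real and the result does not depend on the chosen decomposition. *)
Definition hermfun (R : realType) (N : nat) (f : R -> R) (H : 'M[R[i]]_N) :
    'M[R[i]]_N :=
  invmx (spectralmx H)
    *m diag_mx (map_mx (fun z : R[i] => (f (complex.Re z))%:C) (spectral_diag H))
    *m spectralmx H.

(* Only used for H positive semidefinite and r > 0; then 0 `^ r = 0. *)
Definition mxpowR (R : realType) (N : nat) (H : 'M[R[i]]_N) (r : R) :
    'M[R[i]]_N :=
  hermfun (fun x : R => x `^ r) H.

Definition qsymmod (R : realType) (N : nat) (Z : 'M[R[i]]_N) : 'M[R[i]]_N :=
  mxpowR (2^-1 *: (Z ^t* *m Z + Z *m Z ^t*)) 2^-1.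

(* Nonnegativity follows from the triangle inequality and homogeneity. *)
Record mxnorm (R : realType) (N : nat) (nrm : 'M[R[i]]_N -> R) : Prop := {
  mxnorm_eq0 : forall X, nrm X = 0 -> X = 0;
  mxnormZ : forall (a : R[i]) X, nrm (a *: X) = complex.Re `|a| * nrm X;
  mxnormD : forall X Y, nrm (X + Y) <= nrm X + nrm Y
}.

Definition unitarily_invariant (R : realType) (N : nat)
    (nrm : 'M[R[i]]_N -> R) : Prop :=
  forall X U V : 'M[R[i]]_N, U \is unitarymx -> V \is unitarymx ->
    nrm (U *m X *m V) = nrm X.

(* [unitarymx] on an m x n matrix U reads U U^* = I_m, i.e. orthonormal rows,
   whereas an isometry has orthonormal columns. *)
Definition isometrymx (R : realType) (m n : nat) (U : 'M[R[i]]_(m, n)) : Prop :=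
  U ^t* *m U = 1%:M.

(* Main.v *)
(* Write q = p / 2 and |Z|_qsym^2 = (Z^* Z + Z Z^* ) / 2.  Since U is an isometry,
   the |A_j|_qsym^2 and the |B_i|_qsym^2 have the same sum S, so it suffices to
   compare, for n positive semidefinite L_j, the norms of Sum L_j^q and of
   (Sum L_j)^q:
     q >= 1:  |||Sum L_j^q||| <= |||(Sum L_j)^q||| <= n^(q-1) |||Sum L_j^q|||,
   with both inequalities reversed for q <= 1.
   For the factor n^(q-1), Jensen's inequality on unit vectors and a
   Courant-Fischer dimension count show that the eigenvalues of
   (1/n) Sum L_j^s are dominated one by one by those of ((1/n) Sum L_j)^s when
   s <= 1.
   The other inequality (Ando-Zhan, Bourin-Uchiyama) rests on the following fact
   for s <= 1: if Sum L_j has eigenpairs (lam_l, x_l) and T indexes its largest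
   eigenvalues, then
     Sum_{l in T} lam_l^s <= Sum_{l in T} <(Sum_j L_j^s) x_l, x_l>.
   It is proved for each eigenvector v of each L_j separately: Sum L_j >= a v v^*
   bounds <(Sum L_j)^-1 v, v> by 1/a, and Jensen does the rest.  The resulting
   weak majorization passes to the norm by transfers between two coordinates,
   and a diagonal is dominated by its matrix by pinching. *)

Require Import Defs.
From HB Require Import structures.
From mathcomp Require Import all_boot all_order all_algebra.
From mathcomp Require Import fingroup perm.
From mathcomp Require Import complex.
From mathcomp Require Import reals exp.
From mathcomp Require Import ring lra zify.

Set Implicit Arguments.
Unset Strict Implicit.
Unset Printing Implicit Defensive.

Import Order.TTheory GRing.Theory Num.Theory.

Local Open Scope ring_scope.

(** * Young and Jensen inequalities for real powers *)

Section RealPowers.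
Variable R : realType.
Implicit Types (s a b c : R).

Lemma ler_powR2r s a b : 0 <= s -> 0 <= a -> a <= b -> a `^ s <= b `^ s.
Proof.
by move=> s0 a0 ab; apply: ge0_ler_powR; rewrite ?nnegrE // (le_trans a0).
Qed.

Lemma powRVK s a : s != 0 -> 0 <= a -> (a `^ s) `^ s^-1 = a.
Proof. by move=> s0 a0; rewrite -powRrM divff // powRr1. Qed.

Lemma powR_young s a b : 0 < s < 1 -> 0 <= a -> 0 <= b ->
  a `^ s * b `^ (1 - s) <= s * a + (1 - s) * b.
Proof.
move=> /andP[s0 s1] a0 b0; have s1' : 0 < 1 - s by rewrite subr_gt0.
have := @conjugate_powR R (a `^ s) (b `^ (1 - s)) s^-1 (1 - s)^-1
  (powR_ge0 _ _) (powR_ge0 _ _).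
rewrite !invr_gt0 !invrK => /(_ s0 s1'); rewrite addrC subrK => /(_ erefl).
by rewrite !powRVK ?gt_eqF // mulrC [X in _ <= X]addrC mulrC addrC
  [a * _]mulrC [b * _]mulrC.
Qed.

Section Jensen.
Variables (I : finType) (w t : I -> R).
Hypotheses (w0 : forall i, 0 <= w i) (w1 : \sum_i w i = 1).
Hypothesis t0 : forall i, 0 <= t i.

(** The power function lies below its tangent at the mean [c], which is Young's inequality;
    averaging the tangent over the weights gives [c] to the power [s]. The cases [s = 1] and [c = 0]
    are set apart: [powR_young] asks for [s < 1], and the tangent divides by a power of [c]. *)
Lemma jensen_powR s : 0 < s <= 1 ->
  \sum_i w i * t i `^ s <= (\sum_i w i * t i) `^ s.
Proof.
case/andP=> s0; rewrite le_eqVlt => /predU1P[->|s1].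
  rewrite powRr1 ?sumr_ge0 // => [|i _]; last by rewrite mulr_ge0.
  by apply: ler_sum => i _; rewrite powRr1.
set c := \sum_i w i * t i.
have c0 : 0 <= c by apply: sumr_ge0 => i _; rewrite mulr_ge0.
move: (c0); rewrite le_eqVlt => /predU1P[c_eq0|c_gt0].
  rewrite -c_eq0 powR0 ?gt_eqF // big1 // => i _.
  have /psumr_eq0P/(_ i isT)/eqP : \sum_i w i * t i = 0 by rewrite -/c.
  rewrite mulf_eq0 => /(_ _)/orP[j _|/eqP->|/eqP->]; rewrite ?mul0r //.
    by rewrite mulr_ge0.
  by rewrite powR0 ?mulr0 ?gt_eqF.
have cs : 0 < c `^ (1 - s) by rewrite powR_gt0.
have tangent i : t i `^ s <= (s * t i + (1 - s) * c) / c `^ (1 - s).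
  by rewrite ler_pdivlMr // powR_young ?s0.
apply: (@le_trans _ _ (\sum_i w i * ((s * t i + (1 - s) * c) / c `^ (1 - s)))).
  by apply: ler_sum => i _; rewrite ler_wpM2l.
have -> : \sum_i w i * ((s * t i + (1 - s) * c) / c `^ (1 - s)) =
          (s * c + (1 - s) * c * \sum_i w i) / c `^ (1 - s).
  rewrite /c !mulr_sumr mulrDl !mulr_suml -big_split /=.
  by apply: eq_bigr => i _; ring.
rewrite w1 mulr1 ler_pdivrMr // -powRD; last by rewrite (gt_eqF c_gt0) implybT.
by rewrite addrCA subrr addr0 powRr1 // mulrBl mul1r addrC subrK.
Qed.

End Jensen.

(** Concave Jensen with exponent [r^-1] at the two points [c ^ r] and [d ^ r], raised to the power
    [r]. *)
Lemma convex_powR2 r a b c d : 1 <= r -> 0 <= a -> 0 <= b -> 0 <= c -> 0 <= d ->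
  a + b = 1 -> (a * c + b * d) `^ r <= a * c `^ r + b * d `^ r.
Proof.
move=> r1 a0 b0 c0 d0 ab; have r0 : 0 < r by apply: lt_le_trans r1.
pose w (i : bool) := if i then a else b.
pose t (i : bool) := (if i then c else d) `^ r.
have := @jensen_powR bool w t _ _ _ r^-1.
rewrite !big_bool /= !powRVK ?gt_eqF // => /(_ _ _ _ _) jen.
have {jen} le1 : a * c + b * d <= (a * c `^ r + b * d `^ r) `^ r^-1.
  by apply: jen => [[]|//|i|]; rewrite ?powR_ge0 // invr_gt0 r0 invf_le1.
apply: le_trans (ler_powR2r (ltW r0) _ le1) _; first by rewrite addr_ge0 ?mulr_ge0.
by rewrite -powRrM mulVf ?gt_eqF // powRr1 // addr_ge0 ?mulr_ge0 ?powR_ge0.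
Qed.

End RealPowers.

(** * Sums over sets of largest values, with ties split arbitrarily *)

Definition upset (R : realType) (I : finType) (f : I -> R) (T : {set I}) : Prop :=
  forall i j, i \in T -> j \notin T -> f j <= f i.

Section TopSums.
Variables (R : realType) (I : finType).
Implicit Types (x mu d : I -> R) (T : {set I}).

(* Subtracting from the full sum the part outside T, where the
   inequality goes the other way, handles a > lam l for some l in T.  Since
   0^-1 = 0, the indices with lam l = 0 drop out of the sums. *)
Lemma top_weighted_powR (w lam : I -> R) s a T :
  (forall l, 0 <= w l) -> \sum_l w l = 1 -> (forall l, 0 <= lam l) ->
  0 < s <= 1 -> 0 < a -> (forall l, lam l = 0 -> w l = 0) ->
  a * (\sum_l w l * (lam l)^-1) <= 1 -> upset lam T ->
  \sum_(l in T) w l * a * ((lam l)^-1) `^ (1 - s) <= \sum_(l in T) w l * a `^ s.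
Proof.
move=> w0 w1 lam0 /andP[s0 s1] a0 lamw aw upT.
have anti (x y : R) : 0 < x -> x <= y -> y^-1 `^ (1 - s) <= x^-1 `^ (1 - s).
  move=> x0 xy; apply: ler_powR2r; rewrite ?subr_ge0 ?invr_ge0 //.
    by apply: le_trans xy; apply: ltW.
  by rewrite lef_pV2 // posrE // (lt_le_trans x0).
have asE : a * a^-1 `^ (1 - s) = a `^ s.
  rewrite -[a^-1]powR_inv1 ?(ltW a0) // -powRrM mulN1r opprB.
  by rewrite mulr_powRB1 ?(ltW a0).
have [/forall_inP aT|] := boolP [forall (l | l \in T), a <= lam l].
  apply: ler_sum => l lT; rewrite -mulrA -asE ler_wpM2l // ler_wpM2l ?(ltW a0) //.
  by apply: anti => //; apply: aT.
move=> /forall_inPn[l0 l0T]; rewrite -ltNge => l0a.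
(* Over all indices, Jensen with exponent [1 - s] at the points [(lam l)^-1] applies, their weighted
   mean being at most [a^-1]. For [s = 1] this exponent is 0, outside the range of [jensen_powR],
   and the two sides are equal. *)
have total : \sum_l w l * a * ((lam l)^-1) `^ (1 - s) <= \sum_l w l * a `^ s.
  rewrite -mulr_suml w1 mul1r -asE.
  under eq_bigr do rewrite -mulrA mulrCA.
  rewrite -mulr_sumr ler_wpM2l ?(ltW a0) //.
  have [s1'|] := eqVneq s 1.
    rewrite s1' subrr powRr0; under eq_bigr do rewrite powRr0 mulr1.
    by rewrite w1.
  move=> sn1.
  have h0 : 0 < 1 - s by rewrite subr_gt0 lt_neqAle sn1.
  apply: (@le_trans _ _ ((\sum_l w l * (lam l)^-1) `^ (1 - s))).
    apply: jensen_powR => // [i|]; first by rewrite invr_ge0.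
    by rewrite h0 /= lerBlDr lerDl ltW.
  apply: ler_powR2r; rewrite ?(ltW h0) //.
    by apply: sumr_ge0 => l _; rewrite mulr_ge0 ?invr_ge0.
  by rewrite -[a^-1]mul1r ler_pdivlMr // mulrC.
have compl : \sum_(l | l \notin T) w l * a `^ s <=
             \sum_(l | l \notin T) w l * a * ((lam l)^-1) `^ (1 - s).
  apply: ler_sum => l lT.
  have [/lamw ->|laml] := eqVneq (lam l) 0; first by rewrite !mul0r.
  rewrite -mulrA -asE ler_wpM2l // ler_wpM2l ?(ltW a0) //.
  apply: anti; first by rewrite lt_neqAle eq_sym laml lam0.
  by apply: ltW; apply: le_lt_trans (upT _ _ l0T lT) l0a.
move: total; rewrite (bigID (mem T)) [X in _ <= X](bigID (mem T)) /=.
by move: compl => /= h1 h2; lra.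
Qed.

Lemma upset_powR (lam : I -> R) s T : 0 < s -> (forall l, 0 <= lam l) ->
  upset (fun l => lam l `^ s) T -> upset lam T.
Proof.
move=> s0 lam0 upT i j iT jT; have := upT i j iT jT.
by rewrite !leNgt; apply: contra => lt; apply: gt0_ltr_powR; rewrite ?nnegrE.
Qed.

End TopSums.

(** * Weak majorization and monotone functionals *)

Section Majorization.
Variables (R : realType) (I : finType).
Implicit Types (x mu d : I -> R) (T : {set I}).

(** Later [Psi u] is the norm of the diagonal matrix with entries [u l] to the power [r].
    [Psi_transfer] says that averaging a vector with a transposed copy of itself does not increase
    [Psi]. *)
Variable Psi : (I -> R) -> R.
Hypothesis Psi_mono :
  forall x y : I -> R, (forall i, 0 <= x i <= y i) -> Psi x <= Psi y.
Hypothesis Psi_transfer : forall x i j t, (forall k, 0 <= x k) -> 0 <= t <= 1 ->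
  Psi (fun k => (1 - t) * x k + t * x (tperm i j k)) <= Psi x.

(* Each step is a Robin Hood transfer from a coordinate with d > mu to the
   coordinate l of largest mu among those with d < mu; it creates a new
   coordinate where d = mu. *)
Lemma weak_majorization_le mu d :
  (forall i, 0 <= mu i) -> (forall i, 0 <= d i) ->
  (forall T, upset mu T -> \sum_(i in T) mu i <= \sum_(i in T) d i) ->
  Psi mu <= Psi d.
Proof.
move=> mu0; have [k] := ubnP #|[set l | mu l != d l]|.
elim: k d => // k IH d cardk d0 maj.
have [/forallP le|/forallPn[l0]] := boolP [forall l, mu l <= d l].
  by apply: Psi_mono => l; rewrite mu0 le.
rewrite -ltNge => l0P.
case: (@arg_maxP _ _ _ l0 (fun l => d l < mu l) mu l0P) => l dl lmax.
pose T0 := l |: [set k | mu l < mu k].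
have upT0 : upset mu T0.
  move=> i j; rewrite !inE negb_or -leNgt => /orP[/eqP->|li] /andP[_ jl] //.
  by apply: ltW; apply: le_lt_trans li.
(* Otherwise [d <= mu] on [T0], strictly at [l], against the majorization on the upset [T0]. *)
have [i iT0 di] : exists2 i, i \in T0 & mu i < d i.
  apply/exists_inP; apply: contraT => /exists_inPn nex.
  have := maj _ upT0; rewrite leNgt => /negP[].
  rewrite (bigD1 l) ?setU11 //= [X in _ < X](bigD1 l) ?setU11 //=.
  apply: ltr_leD => //; apply: ler_sum => j /andP[jT _].
  by rewrite leNgt; apply: nex.
have il : i != l by apply: contraTneq di => ->; rewrite -leNgt ltW.
have mui : mu l <= mu i.
  by move: iT0; rewrite !inE (negbTE il) /= => /ltW.
pose e := Num.min (d i - mu i) (mu l - d l).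
have e0 : 0 < e by rewrite lt_min !subr_gt0 di.
have ei : e <= d i - mu i by rewrite ge_min lexx.
have el : e <= mu l - d l by rewrite ge_min lexx orbT.
(* The amount [e] is the smaller of the two gaps, so it closes one of them and overshoots
   neither. *)
pose d' k := d k - e * (k == i)%:R + e * (k == l)%:R.
have d'i : d' i = d i - e by rewrite /d' eqxx (negbTE il) mulr1 mulr0 addr0.
have d'l : d' l = d l + e.
  by rewrite /d' eqxx eq_sym (negbTE il) mulr1 mulr0 subr0.
have d'k j : j != i -> j != l -> d' j = d j.
  by rewrite /d' => /negbTE-> /negbTE->; rewrite mulr0 subr0 addr0.
have d'0 j : 0 <= d' j.
  have [->|ji] := eqVneq j i; first by rewrite d'i; have := mu0 i; lra.
  have [->|jl] := eqVneq j l; first by rewrite d'l; have := d0 l; lra.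
  by rewrite d'k.
have sum_ind T j : \sum_(h in T) e * (h == j)%:R = e * (j \in T)%:R.
  rewrite -mulr_sumr; congr (_ * _); case: (boolP (j \in T)) => jT.
    rewrite (bigD1 j) //= eqxx big1 ?addr0 // => h /andP[_ /negbTE->] //.
  by rewrite big1 // => h hT; case: eqVneq hT => // ->; rewrite (negbTE jT).
have sum_d' T : \sum_(h in T) d' h =
    \sum_(h in T) d h - e * (i \in T)%:R + e * (l \in T)%:R.
  by rewrite big_split sumrB /= !sum_ind.
apply: (@le_trans _ _ (Psi d')).
  apply: IH => //.
    rewrite -ltnS; apply: leq_trans cardk; rewrite ltnS.
    apply: proper_card; apply/properP; split.
      apply/subsetP => j; rewrite !inE.
      have [->|ji] := eqVneq j i; first by rewrite (lt_eqF di).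
      have [->|jl] := eqVneq j l; first by rewrite (gt_eqF dl).
      by rewrite d'k.
    have [ie|ie] := leP (d i - mu i) (mu l - d l).
      exists i; rewrite !inE ?(lt_eqF di) //.
      by rewrite d'i /e min_l // opprB addrC subrK eqxx.
    exists l; rewrite !inE ?(gt_eqF dl) //.
    by rewrite d'l /e min_r ?ltW // addrC subrK eqxx.
  move=> T upT; rewrite sum_d'.
  have [iT|iT] := boolP (i \in T); have [lT|lT] := boolP (l \in T);
    rewrite ?mulr1 ?mulr0 ?subr0 ?addr0 ?subrK; try exact: maj.
    (* Only here, with [i] in [T] and [l] outside, does the sum of [d] over [T] drop. If some [h] in
       [T] is deficient, the choice of [l] makes [l |: T] an upset, and its inequality leaves room
       for [mu l - d l >= e]. If none is, then [mu <= d] on [T], and the gap at [i] alone absorbs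
       [e]. *)
    have [/exists_inP[h hT hd]|/exists_inPn nex] :=
        boolP [exists (h | h \in T), d h < mu h].
      have upTl : upset mu (l |: T).
        move=> a b; rewrite !inE negb_or.
        move=> /predU1P[->|aT] /andP[bl bT]; last exact: upT.
        by apply: le_trans (lmax _ hd); apply: upT.
      have := maj _ upTl; rewrite !big_setU1 //=; lra.
    have : \sum_(h in T | h != i) mu h <= \sum_(h in T | h != i) d h.
      by apply: ler_sum => h /andP[hT _]; rewrite leNgt; apply: nex.
    by move=> le; rewrite (bigD1 i) //= [X in _ <= X - _](bigD1 i) //=; lra.
  by apply: le_trans (maj _ upT) _; rewrite lerDl ltW.
have dil : 0 < d i - d l by lra.
(* The weight for which averaging [d] with its transposed copy moves exactly [e] from [i] to [l]. *)
pose t := e / (d i - d l).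
have tE : t * (d i - d l) = e by rewrite mulfVK // gt_eqF.
have t01 : 0 <= t <= 1.
  rewrite divr_ge0 ?(ltW e0) ?(ltW dil) //= ler_pdivrMr // mul1r; lra.
apply: le_trans (Psi_transfer i l d0 t01).
apply: Psi_mono => j; rewrite d'0 /=.
have [->|ji] := eqVneq j i; first by rewrite d'i tpermL -tE; lra.
have [->|jl] := eqVneq j l; first by rewrite d'l tpermR -tE; lra.
by rewrite d'k // tpermD 1?eq_sym //; lra.
Qed.

End Majorization.

(** * Comparing two families by their decreasing rearrangements *)

Lemma sorting_perm (R : realType) (N : nat) (f : 'I_N -> R) :
  exists s : {perm 'I_N}, forall i j : 'I_N, (i <= j)%N -> f (s j) <= f (s i).
Proof.
pose t := [tuple f i | i < N].
have szt : size (sort >=%R t) == N by rewrite size_sort size_tuple.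
have /tuple_permP[s sE] : perm_eq (Tuple szt) t by rewrite /= perm_sort.
exists s => i j ij.
have nthE (k : 'I_N) : f (s k) = nth 0 (sort >=%R t) k.
  rewrite -[sort _ _]/(tval (Tuple szt)) sE /= (nth_map k) ?size_enum_ord //.
  by rewrite nth_ord_enum tnth_mktuple.
have ge_trans : transitive (>=%R : rel R).
  by move=> a b c ba cb; apply: le_trans cb ba.
have ge_refl : reflexive (>=%R : rel R) by move=> a /=.
have ge_total : total (>=%R : rel R) by move=> a b; apply: le_total.
rewrite !nthE.
by apply: (sorted_leq_nth ge_trans ge_refl 0 (sort_sorted ge_total t) i j) => //;
  rewrite inE (eqP szt).
Qed.

Lemma card_ltn_ord (N k : nat) : (k <= N)%N -> #|[set j : 'I_N | (j < k)%N]| = k.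
Proof.
move=> kN; rewrite cardsE -sum1_card -(big_ord_widen _ (fun=> 1%N)) //.
by rewrite sum1_card card_ord.
Qed.

(** The [k]-th largest value of [f] is matched with the [k]-th largest of [g], counting from 0. If
    the former were larger, then at the level [c] of the latter at least [k + 1] values of [f] but
    at most [k] values of [g] would exceed [c]. *)
Lemma dominating_perm (R : realType) (N : nat) (f g : 'I_N -> R) :
  (forall c, (#|[set i | (c < f i)%R]| <= #|[set i | (c < g i)%R]|)%N) ->
  exists s : {perm 'I_N}, forall i, f i <= g (s i).
Proof.
move=> cnt; have [s sP] := sorting_perm f; have [t tP] := sorting_perm g.
exists (s^-1 * t)%g => i; rewrite permM; set k := (s^-1 i)%g.
have -> : f i = f (s k) by rewrite permKV.
rewrite leNgt; apply/negP => fg; move: (cnt (g (t k))); apply/negP; rewrite -ltnNge.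
apply: (@leq_trans k.+1).
  rewrite ltnS; apply: (@leq_trans #|t @: [set j : 'I_N | (j < k)%N]|).
    apply/subset_leq_card/subsetP => j; rewrite inE => kj.
    apply/imsetP; exists (t^-1 j)%g; rewrite ?permKV // inE ltnNge.
    by apply: contraTN kj => /tP; rewrite permKV -leNgt.
  rewrite card_imset; last exact: perm_inj.
  by rewrite card_ltn_ord // ltnW.
apply: (@leq_trans #|s @: [set j : 'I_N | (j < k.+1)%N]|).
  rewrite card_imset; last exact: perm_inj.
  by rewrite (@card_ltn_ord N k.+1).
apply/subset_leq_card/subsetP => j /imsetP[h]; rewrite !inE => /sP hk ->.
by apply: lt_le_trans hk.
Qed.

Local Open Scope complex_scope.
Local Open Scope sesquilinear_scope.

(** * Spectral decompositions, functional calculus and positive semidefinite matrices *)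

Section Spectral.
Variable R : realType.
Local Notation C := R[i].

Definition nsq (z : C) : R := complex.Re (z * z^*%R).

Lemma nsqE z : (nsq z)%:C = z * z^*%R.
Proof.
by rewrite /nsq RRe_real // realE mul_conjC_ge0.
Qed.

Lemma nsq_ge0 z : 0 <= nsq z.
Proof. by rewrite -ler0c nsqE mul_conjC_ge0. Qed.

Lemma nsq_eq0 z : nsq z = 0 -> z = 0.
Proof.
by move=> /(congr1 (@real_complex_def R (Phant R))); rewrite nsqE => /eqP;
  rewrite mul_conjC_eq0 => /eqP.
Qed.

Lemma nsqJ z : nsq (z^*%R) = nsq z.
Proof. by rewrite /nsq conjCK mulrC. Qed.

Lemma tmxcM m n p (A : 'M[C]_(m, n)) (B : 'M_(n, p)) :
  (A *m B) ^t* = B ^t* *m A ^t*.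
Proof. by rewrite trmx_mul map_mxM. Qed.

Lemma tmxcD m n (A B : 'M[C]_(m, n)) : (A + B) ^t* = A ^t* + B ^t*.
Proof. by rewrite linearD map_mxD. Qed.

Lemma tmxc_sum m n (I : finType) (F : I -> 'M[C]_(m, n)) :
  (\sum_i F i) ^t* = \sum_i (F i) ^t*.
Proof. by rewrite linear_sum raddf_sum. Qed.

Lemma tmxcZ m n (a : C) (A : 'M[C]_(m, n)) : (a *: A) ^t* = a^*%R *: A ^t*.
Proof. by rewrite linearZ map_mxZ. Qed.

Variable N : nat.
Implicit Types (V W M X : 'M[C]_N) (d a lam : 'I_N -> R).

Definition rdiag d : 'M[C]_N := diag_mx (\row_l (d l)%:C).
(** For unitary [V], the eigenvectors are the rows of [V], as in [hermfun]. *)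
Definition spec V d : 'M[C]_N := V ^t* *m rdiag d *m V.

Definition diag_in V M (l : 'I_N) : R := complex.Re ((V *m M *m V ^t*) l l).

Lemma eq_rdiag d a : d =1 a -> rdiag d = rdiag a.
Proof. by move=> e; congr diag_mx; apply/rowP => l; rewrite !mxE e. Qed.

Lemma eq_spec V d a : d =1 a -> spec V d = spec V a.
Proof. by move=> /eq_rdiag e; rewrite /spec e. Qed.

Lemma unitary_mulCmx V : V \is unitarymx -> V *m V ^t* = 1%:M.
Proof. by move/unitarymxP. Qed.

Lemma unitary_mulmxC V : V \is unitarymx -> V ^t* *m V = 1%:M.
Proof.
move=> uV; apply: mulmx1C; exact: unitary_mulCmx.
Qed.

Lemma unitary_tmxc V : V \is unitarymx -> V ^t* \is unitarymx.
Proof. by move=> uV; apply/unitarymxP; rewrite trmxCK unitary_mulmxC. Qed.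

Lemma unitary_1mx : (1%:M : 'M[C]_N) \is unitarymx.
Proof. by apply/unitarymxP; rewrite trmx1 map_mx1 mulmx1. Qed.

(** A rectangular [Y] covers both a change of basis and a single row vector. The squared overlaps
    become the weights for Jensen's inequality. *)
Lemma spec_conj m (Y : 'M[C]_(m, N)) V a l :
  (Y *m spec V a *m Y ^t*) l l = (\sum_i nsq ((Y *m V ^t*) l i) * a i)%:C.
Proof.
have -> : Y *m spec V a *m Y ^t* = (Y *m V ^t*) *m rdiag a *m (Y *m V ^t*) ^t*.
  by rewrite tmxcM trmxCK /spec !mulmxA.
rewrite mul_mx_diag mxE rmorph_sum /=; apply: eq_bigr => i _.
by rewrite !mxE rmorphM /= nsqE mulrAC.
Qed.

Lemma diag_in_spec V W a l :
  diag_in V (spec W a) l = \sum_i nsq ((V *m W ^t*) l i) * a i.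
Proof. by rewrite /diag_in spec_conj. Qed.

Lemma diag_in_sum V (I : finType) (M : I -> 'M[C]_N) l :
  diag_in V (\sum_j M j) l = \sum_j diag_in V (M j) l.
Proof.
rewrite /diag_in mulmx_sumr mulmx_suml summxE.
exact: (raddf_sum (@complex.Re R : Rcomplex R -> R)).
Qed.

Lemma diag_in_self V a l : V \is unitarymx -> diag_in V (spec V a) l = a l.
Proof.
move=> uV; rewrite diag_in_spec unitary_mulCmx // (bigD1 l) //= big1 ?addr0.
  by rewrite mxE eqxx /nsq mul1r conjC1 mul1r.
by move=> i il; rewrite mxE eq_sym (negbTE il) /nsq mul0r mul0r.
Qed.

Lemma nsq_row_sum m (Y : 'M[C]_(m, N)) V l : V \is unitarymx ->
  (\sum_i nsq ((Y *m V ^t*) l i))%:C = (Y *m Y ^t*) l l.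
Proof.
move=> uV; have := spec_conj Y V (fun=> 1) l.
have -> : spec V (fun=> 1) = 1%:M.
  rewrite /spec; have -> : rdiag (fun=> 1) = 1%:M.
    by apply/matrixP => i j; rewrite !mxE.
  by rewrite mulmx1 unitary_mulmxC.
by rewrite mulmx1 => ->; congr (_%:C); apply: eq_bigr => i _; rewrite mulr1.
Qed.

Lemma nsq_row_sum1 V W l : V \is unitarymx -> W \is unitarymx ->
  \sum_i nsq ((W *m V ^t*) l i) = 1.
Proof.
move=> uV uW; apply: complexI.
by rewrite nsq_row_sum // unitary_mulCmx // mxE eqxx.
Qed.

Lemma nsq_overlapC V W l i : nsq ((V *m W ^t*) l i) = nsq ((W *m V ^t*) i l).
Proof.
by rewrite -[V in LHS]trmxCK -tmxcM !mxE nsqJ.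
Qed.

Lemma spec_herm V d : (spec V d) ^t* = spec V d.
Proof.
have rH : (rdiag d) ^t* = rdiag d.
  apply/matrixP => i j; rewrite !mxE eq_sym; case: eqVneq => [->|_].
    by rewrite !mulr1n; apply: conjc_real.
  by rewrite !mulr0n conjC0.
by rewrite /spec tmxcM tmxcM trmxCK rH mulmxA.
Qed.

(** Independence of the functional calculus from the decomposition. The unitary [W = P V^*]
    intertwines the two diagonal matrices, so [e k = d l] wherever [W k l] is nonzero; [W] then
    intertwines their images under [f] as well. *)
Lemma spectral_intertwine (P : 'M[C]_N) (e : 'rV[C]_N) V d (f : R -> R) :
  P \is unitarymx -> V \is unitarymx ->
  P ^t* *m diag_mx e *m P = spec V d ->
  P ^t* *m diag_mx (map_mx (fun z : C => (f (complex.Re z))%:C) e) *m P =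
  spec V (f \o d).
Proof.
move=> uP uV PV; have [W WE] : exists W, W = P *m V ^t* by eexists.
have uW : W \is unitarymx by rewrite WE; apply: mul_unitarymx uP (unitary_tmxc uV).
have PE : P = W *m V by rewrite WE -mulmxA unitary_mulmxC // mulmx1.
have eW : diag_mx e *m W = W *m rdiag d.
  have := congr1 (fun X => P *m X *m V ^t*) PV.
  rewrite /spec !mulmxA unitary_mulCmx // mul1mx -mulmxA -WE => ->.
  by rewrite -mulmxA unitary_mulCmx // mulmx1 WE.
have feW : diag_mx (map_mx (fun z : C => (f (complex.Re z))%:C) e) *m W =
    W *m rdiag (f \o d).
  apply/matrixP => k l; have := congr1 (fun A : 'M[C]_N => A k l) eW.
  rewrite !mul_diag_mx !mul_mx_diag !mxE.
  have [->|W0] := eqVneq (W k l) 0; first by rewrite !mulr0 !mul0r.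
  by rewrite mulrC => /(mulfI W0) -> /=; rewrite mulrC.
rewrite PE tmxcM /spec -!mulmxA [_ *m (W *m V)]mulmxA feW -!mulmxA.
by rewrite [W ^t* *m _]mulmxA unitary_mulmxC ?mul1mx.
Qed.

Lemma normal_spectral M : M \is normalmx ->
  M = (spectralmx M) ^t* *m diag_mx (spectral_diag M) *m spectralmx M.
Proof.
move=> nM; rewrite -(invmx_unitary (spectral_unitarymx M)).
by apply/orthomx_spectralP.
Qed.

Lemma hermfun_spec V d f : V \is unitarymx ->
  hermfun f (spec V d) = spec V (f \o d).
Proof.
move=> uV; have nH : spec V d \is normalmx by apply/normalmxP; rewrite spec_herm.
rewrite /hermfun (invmx_unitary (spectral_unitarymx _)).
apply: (spectral_intertwine f (spectral_unitarymx _) uV).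
exact: esym (normal_spectral nH).
Qed.

(** In the order of [R[i]], [0 <= z] also says that [z] is real. *)
Definition psd M : Prop :=
  M ^t* = M /\ forall v : 'rV[C]_N, 0 <= (v *m M *m v ^t*) 0 0.

Lemma conj_row m (Y : 'M[C]_(m, N)) M l :
  (Y *m M *m Y ^t*) l l = (row l Y *m M *m (row l Y) ^t*) 0 0.
Proof.
rewrite -row_mul !mxE; apply: eq_bigr => k _; rewrite !mxE; congr (_ * _).
Qed.

Lemma psd_conj_ge0 m (Y : 'M[C]_(m, N)) M l : psd M -> 0 <= (Y *m M *m Y ^t*) l l.
Proof. by case=> _ M0; rewrite conj_row. Qed.

Lemma psd_spec V d : (forall l, 0 <= d l) -> psd (spec V d).
Proof.
move=> d0; split=> [|v]; first exact: spec_herm.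
by rewrite spec_conj ler0c sumr_ge0 // => i _; rewrite mulr_ge0 ?nsq_ge0.
Qed.

Lemma psd_spectral M : psd M ->
  exists V d, [/\ V \is unitarymx, forall l, 0 <= d l & M = spec V d].
Proof.
move=> pM; have nM : M \is normalmx by apply/normalmxP; rewrite pM.1.
have := normal_spectral nM; have := spectral_unitarymx M.
move: (spectralmx M) (spectral_diag M) => P e uP ME.
have eE : P *m M *m P ^t* = diag_mx e.
  rewrite ME !mulmxA unitary_mulCmx // mul1mx -mulmxA unitary_mulCmx //.
  by rewrite mulmx1.
have e0 l : 0 <= e 0 l.
  by have := psd_conj_ge0 P l pM; rewrite eE mxE eqxx mulr1n.
exists P, (fun l => complex.Re (e 0 l)); split; first by [].
  by move=> l; rewrite -ler0c RRe_real ?ger0_real.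
have eR : e = \row_l (complex.Re (e 0 l))%:C.
  by apply/rowP => l; rewrite mxE RRe_real ?ger0_real.
by rewrite ME {1}eR.
Qed.

Lemma psd_sum (I : finType) (M : I -> 'M[C]_N) :
  (forall j, psd (M j)) -> psd (\sum_j M j).
Proof.
move=> pM; split=> [|v].
  by rewrite tmxc_sum; apply: eq_bigr => j _; case: (pM j).
rewrite mulmx_sumr mulmx_suml summxE; apply: sumr_ge0 => j _.
by case: (pM j) => _; apply.
Qed.

Lemma psd_scale (c : R) M : 0 <= c -> psd M -> psd (c%:C *: M).
Proof.
move=> c0 [hM M0]; split=> [|v].
  by rewrite tmxcZ hM; congr (_ *: _); apply: conjc_real.
by rewrite -scalemxAr -scalemxAl mxE mulr_ge0 ?ler0c.
Qed.

Lemma psd_gram m (Y : 'M[C]_(m, N)) : psd (Y ^t* *m Y).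
Proof.
split=> [|v]; first by rewrite tmxcM trmxCK.
have -> : v *m (Y ^t* *m Y) *m v ^t* = (v *m Y ^t*) *m (v *m Y ^t*) ^t*.
  by rewrite tmxcM trmxCK !mulmxA.
by rewrite mxE sumr_ge0 // => i _; rewrite !mxE mul_conjC_ge0.
Qed.

Lemma psdD M X : psd M -> psd X -> psd (M + X).
Proof.
move=> [hM M0] [hX X0]; split=> [|v]; first by rewrite tmxcD hM hX.
by rewrite mulmxDr mulmxDl mxE addr_ge0.
Qed.

Lemma mxpowR_spec V d r : V \is unitarymx ->
  mxpowR (spec V d) r = spec V (fun l => d l `^ r).
Proof. exact: hermfun_spec. Qed.

Lemma psd_mxpowR M r : psd M -> psd (mxpowR M r).
Proof.
case/psd_spectral => V [d [uV d0 ->]]; rewrite (mxpowR_spec d r uV).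
by apply: psd_spec => l; apply: powR_ge0.
Qed.

(** Serves to absorb the square root in [qsymmod], and to recover [L j] from its power [q] when a
    result for exponents at most 1 is applied with [q^-1]. *)
Lemma mxpowR_mul M r s : psd M -> mxpowR (mxpowR M r) s = mxpowR M (r * s).
Proof.
case/psd_spectral => V [d [uV d0 ->]].
rewrite (congr1 (@mxpowR R N ^~ s) (mxpowR_spec d r uV)).
rewrite (mxpowR_spec d (r * s) uV) (mxpowR_spec (fun l => d l `^ r) s uV).
by apply: eq_spec => l; rewrite powRrM.
Qed.

Lemma mxpowR1 M : psd M -> mxpowR M 1 = M.
Proof.
case/psd_spectral => V [d [uV d0 ->]]; have -> := mxpowR_spec d 1 uV.
by apply: eq_spec => l; rewrite powRr1.
Qed.

End Spectral.

(** * Eigenvalue inequalities for sums of powers *)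

Section SpectralInequalities.
Variables (R : realType) (N : nat).
Local Notation C := R[i].
Implicit Types (V W M X G H L : 'M[C]_N) (d a lam mu : 'I_N -> R).

Definition qform M (v : 'rV[C]_N) : R := complex.Re ((v *m M *m v ^t*) 0 0).

Lemma qform_spec V a v :
  qform (spec V a) v = \sum_i nsq ((v *m V ^t*) 0 i) * a i.
Proof. by rewrite /qform spec_conj. Qed.

Lemma qform_sum (I : finType) (M : I -> 'M[C]_N) v :
  qform (\sum_j M j) v = \sum_j qform (M j) v.
Proof.
rewrite /qform mulmx_sumr mulmx_suml summxE.
exact: (raddf_sum (@complex.Re R : Rcomplex R -> R)).
Qed.

Lemma qform_scale (c : R) M v : qform (c%:C *: M) v = c * qform M v.
Proof.
rewrite /qform -scalemxAr -scalemxAl mxE.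
by case: (_ 0 0) => x y /=; rewrite mul0r subr0.
Qed.

Lemma diag_in_qform V M l : diag_in V M l = qform M (row l V).
Proof. by rewrite /diag_in conj_row. Qed.

Lemma qform_ge0 M v : psd M -> 0 <= qform M v.
Proof. by case=> _ /(_ v); rewrite lecE => /andP[]. Qed.

(** The form inequality is tested on the vector with coordinates [c] in the basis [W]; on the left
    only the term of the eigenvector [i] is kept. *)
Lemma overlap_le V W a lam (i : 'I_N) (c : 'rV[C]_N) :
  W \is unitarymx -> (forall l, 0 <= a l) ->
  (forall v, qform (spec V a) v <= qform (spec W lam) v) ->
  a i * nsq (\sum_l c 0 l * (W *m V ^t*) l i) <= \sum_l nsq (c 0 l) * lam l.
Proof.
move=> uW a0 le; have := le (c *m W); rewrite !qform_spec.
rewrite -!mulmxA unitary_mulCmx // mulmx1; apply: le_trans.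
rewrite [leRHS](bigD1 i) //= [in leRHS]mxE mulrC lerDl.
by apply: sumr_ge0 => j _; rewrite mulr_ge0 ?nsq_ge0.
Qed.

Lemma nsqM (x y : C) : nsq (x * y) = nsq x * nsq y.
Proof. by apply: complexI; rewrite rmorphM /= !nsqE rmorphM mulrACA. Qed.

Lemma nsq_real (x : R) : nsq (x%:C) = x ^+ 2.
Proof.
apply: complexI; rewrite nsqE rmorphXn expr2; congr (_ * _).
exact: conjc_real.
Qed.

(* If X >= a v v^*, then a <v, X^-1 v> <= 1: test X on X^-1 v. *)
Lemma overlap_inv V W a lam (i : 'I_N) :
  W \is unitarymx -> (forall l, 0 <= a l) -> 0 < a i ->
  (forall v, qform (spec V a) v <= qform (spec W lam) v) ->
  (forall l, lam l = 0 -> nsq ((W *m V ^t*) l i) = 0) /\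
  a i * (\sum_l nsq ((W *m V ^t*) l i) * (lam l)^-1) <= 1.
Proof.
move=> uW a0 ai0 le; split=> [l laml|].
  (* The test vector is the eigenvector [l] of [X], on which its form vanishes. *)
  have := overlap_le i (delta_mx 0 l) uW a0 le.
  rewrite (bigD1 l) //= big1 ?addr0 => [|j jl]; last first.
    by rewrite mxE eqxx (negbTE jl) mul0r.
  rewrite (bigD1 l) //= big1 ?addr0 => [|j jl]; last first.
    by rewrite mxE eqxx (negbTE jl) /nsq !mul0r.
  rewrite [delta_mx _ _ _ _]mxE !eqxx mul1r laml mulr0 pmulr_rle0 // => h.
  by apply/eqP; rewrite eq_le nsq_ge0 andbT.
set t := \sum_l _.
(* The coordinates of [X^-1 v] in the basis [W], for [v] the row [i] of [V], with [0^-1 = 0]. The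
   test then reads [a i * t ^+ 2 <= t]. *)
pose c : 'rV[C]_N := \row_l (((W *m V ^t*) l i)^*%R * ((lam l)^-1)%:C).
have := overlap_le i c uW a0 le.
have -> : \sum_l c 0 l * (W *m V ^t*) l i = t%:C.
  rewrite rmorph_sum /=; apply: eq_bigr => l _.
  by rewrite [c 0 l]mxE rmorphM /= nsqE mulrAC [_^*%R * _]mulrC.
have -> : \sum_l nsq (c 0 l) * lam l = t.
  apply: eq_bigr => l _; rewrite [c 0 l]mxE nsqM nsqJ nsq_real -mulrA.
  have [->|laml] := eqVneq (lam l) 0; first by rewrite invr0 mulr0.
  by rewrite expr2 -mulrA mulVf // mulr1.
rewrite nsq_real expr2 mulrA => h.
have [t0|t0] := leP t 0; last by rewrite -(ler_pM2r t0) mul1r.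
by apply: le_trans ler01; rewrite pmulr_rle0.
Qed.

(** Both sides are sums over the eigenvectors of [L]. For each one with a positive eigenvalue, its
    squared overlaps with the basis [W] are the weights of [top_weighted_powR], whose hypotheses
    come from [overlap_inv]. *)
Lemma top_diag_in_powR L X W lam s (T : {set 'I_N}) :
  psd L -> (forall v, qform L v <= qform X v) ->
  W \is unitarymx -> X = spec W lam -> (forall l, 0 <= lam l) -> 0 < s <= 1 ->
  upset lam T ->
  \sum_(l in T) diag_in W L l * (lam l)^-1 `^ (1 - s) <=
  \sum_(l in T) diag_in W (mxpowR L s) l.
Proof.
move=> /psd_spectral[V [a [uV a0 ->]]] le uW XE lam0 s01 upT; subst X.
rewrite mxpowR_spec //.
under eq_bigr do rewrite diag_in_spec mulr_suml.
under [X in _ <= X]eq_bigr do rewrite diag_in_spec.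
rewrite exchange_big [X in _ <= X]exchange_big /=; apply: ler_sum => i _.
have := a0 i; rewrite le_eqVlt => /predU1P[<-|ai0].
  rewrite big1 ?sumr_ge0 // => [l _|l _]; last by rewrite mulr0 mul0r.
  by rewrite mulr_ge0 ?nsq_ge0 ?powR_ge0.
have [lamw alam] := overlap_inv uW a0 ai0 le.
apply: top_weighted_powR => // [l|]; first exact: nsq_ge0.
under eq_bigr do rewrite nsq_overlapC.
exact: nsq_row_sum1.
Qed.

Lemma top_sum_powR (I : finType) (L : I -> 'M[C]_N) W lam s (T : {set 'I_N}) :
  (forall j, psd (L j)) -> W \is unitarymx -> \sum_j L j = spec W lam ->
  (forall l, 0 <= lam l) -> 0 < s <= 1 -> upset lam T ->
  \sum_(l in T) lam l `^ s <=
  \sum_(l in T) diag_in W (\sum_j mxpowR (L j) s) l.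
Proof.
move=> pL uW LE lam0 s01 upT; have /andP[s0 s1] := s01.
(* Writing [lam ^ s] as [lam] times [lam^-1] to the power [1 - s], and [lam l] as a diagonal entry
   of the sum, splits the left side over [j]. *)
have -> : \sum_(l in T) lam l `^ s =
    \sum_(l in T) \sum_j diag_in W (L j) l * (lam l)^-1 `^ (1 - s).
  apply: eq_bigr => l _; rewrite -mulr_suml -diag_in_sum LE diag_in_self //.
  have := lam0 l; rewrite le_eqVlt => /predU1P[<-|l0].
    by rewrite mul0r powR0 ?gt_eqF.
  by rewrite -powR_inv1 // -powRrM mulN1r opprB mulr_powRB1.
under [X in _ <= X]eq_bigr do rewrite diag_in_sum.
rewrite exchange_big [X in _ <= X]exchange_big /=; apply: ler_sum => j _.
apply: (@top_diag_in_powR _ (\sum_j L j)) => // v.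
rewrite qform_sum (bigD1 j) //= lerDl sumr_ge0 // => k _.
exact: qform_ge0.
Qed.

Lemma rowsub_unitary V (P : {set 'I_N}) : V \is unitarymx ->
  rowsub (@enum_val _ (mem P)) V \is unitarymx.
Proof.
move=> uV; apply/unitarymxP/matrixP => i j.
have := congr1 (fun A : 'M[C]_N => A (enum_val i) (enum_val j)) (unitary_mulCmx uV).
rewrite !mxE (inj_eq enum_val_inj) => <-; apply: eq_bigr => k _.
by rewrite !mxE.
Qed.

Lemma sub_rowsub_coord V (P : {set 'I_N}) (v : 'rV[C]_N) l : V \is unitarymx ->
  (v <= rowsub (@enum_val _ (mem P)) V)%MS -> l \notin P ->
  (v *m V ^t*) 0 l = 0.
Proof.
move=> uV /submxP[u ->] lP; rewrite -mulmxA mul_rowsub_mx unitary_mulCmx //.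
rewrite mxE big1 // => k _; rewrite !mxE.
by case: eqVneq lP => [<-|]; rewrite ?mulr0 // enum_valP.
Qed.

(** The rows of [V] in [P] and those of [W] in [Q] span spaces whose dimensions add up to more than
    [N], so they share a nonzero vector. *)
Lemma common_unit_vector V W (P Q : {set 'I_N}) :
  V \is unitarymx -> W \is unitarymx -> (N < #|P| + #|Q|)%N ->
  exists v : 'rV[C]_N, [/\ (v *m v ^t*) 0 0 = 1,
    forall l, l \notin P -> (v *m V ^t*) 0 l = 0 &
    forall l, l \notin Q -> (v *m W ^t*) 0 l = 0].
Proof.
move=> uV uW NPQ.
set E := rowsub (@enum_val _ (mem P)) V; set F := rowsub (@enum_val _ (mem Q)) W.
have rkE : \rank E = #|P| by rewrite mxrank_unitary ?rowsub_unitary.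
have rkF : \rank F = #|Q| by rewrite mxrank_unitary ?rowsub_unitary.
have cap0 : (E :&: F)%MS != 0.
  rewrite -mxrank_eq0 -lt0n; have := mxrank_sum_cap E F; rewrite rkE rkF.
  by have := rank_leq_col (E + F)%MS; lia.
have /rowV0Pn[y /[!sub_capmx]/andP[yE yF] y0] := cap0.
pose t := \sum_k nsq (y 0 k).
have yyE : (y *m y ^t*) 0 0 = t%:C.
  by rewrite mxE rmorph_sum /=; apply: eq_bigr => k _; rewrite nsqE !mxE.
have t0 : 0 < t.
  rewrite lt_def sumr_ge0 => [|k _]; last exact: nsq_ge0.
  rewrite andbT; apply: contraNneq y0 => t0; apply/eqP/rowP => k; rewrite mxE.
  by apply: nsq_eq0; apply: (psumr_eq0P (fun j _ => nsq_ge0 (y 0 j)) t0 (i := k)).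
pose z := ((Num.sqrt t)^-1)%:C.
exists (z *: y); split=> [|l lP|l lQ].
- rewrite tmxcZ -scalemxAl -scalemxAr scalerA mxE yyE -nsqE nsq_real -rmorphM /=.
  by rewrite exprVn sqr_sqrtr ?ltW // mulVf ?gt_eqF.
- by rewrite -scalemxAl mxE (sub_rowsub_coord uV yE lP) mulr0.
- by rewrite -scalemxAl mxE (sub_rowsub_coord uW yF lQ) mulr0.
Qed.

(** If at some level [c] more of the [mu l] than of the [psi (lam l)] exceeded [c], a unit vector
    common to the eigenspaces for [mu > c] and for [psi lam <= c] would contradict the inequality of
    forms. *)
Lemma spectra_dominated_perm V W mu lam (psi : R -> R) :
  V \is unitarymx -> W \is unitarymx ->
  (forall l, 0 <= mu l) -> (forall l, 0 <= lam l) ->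
  (forall x y, 0 <= x -> x <= y -> psi x <= psi y) ->
  (forall v : 'rV[C]_N, (v *m v ^t*) 0 0 = 1 ->
     qform (spec V mu) v <= psi (qform (spec W lam) v)) ->
  exists s : {perm 'I_N}, forall l, mu l <= psi (lam (s l)).
Proof.
move=> uV uW mu0 lam0 psi_mono le.
apply: (@dominating_perm R N mu (fun l => psi (lam l))) => c.
rewrite leqNgt; apply/negP => lt.
pose P := [set l | c < mu l]; pose Q := [set l | psi (lam l) <= c].
have NPQ : (N < #|P| + #|Q|)%N.
  have QC : #|[set l | (c < psi (lam l))%R]| = #|~: Q|.
    by congr #|pred_of_set _|; apply/setP => l; rewrite !inE ltNge.
  have := cardsC Q; rewrite card_ord -QC => {1}<-.
  by rewrite addnC ltn_add2r.
have [v [v1 vP vQ]] := common_unit_vector uV uW NPQ.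
have sum1 (U : 'M[C]_N) : U \is unitarymx -> \sum_l nsq ((v *m U ^t*) 0 l) = 1.
  by move=> uU; apply: complexI; rewrite nsq_row_sum // v1.
have := le v v1; rewrite !qform_spec leNgt => /negP[].
apply: (@le_lt_trans _ _ c).
  have [l0 wl0] : exists l, 0 < nsq ((v *m W ^t*) 0 l).
    apply/existsP; apply: contraT => /existsPn w0.
    have := sum1 _ uW; rewrite big1 => [/esym/eqP|l _]; first by rewrite oner_eq0.
    by apply/eqP; rewrite eq_le nsq_ge0 andbT leNgt w0.
  have l0Q : l0 \in Q.
    by apply: contraTT wl0 => /vQ ->; rewrite /nsq mul0r ltxx.
  (* The form at [v] is at most the largest [lam] over [Q]; as this is attained in [Q], monotonicity
     of [psi] gives the bound [c]. *)
  case: (@arg_maxP _ _ _ l0 (fun l => l \in Q) lam l0Q) => l lQ lmax.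
  apply: (@le_trans _ _ (psi (lam l))); last by move: lQ; rewrite inE.
  apply: psi_mono; first by apply: sumr_ge0 => k _; rewrite mulr_ge0 ?nsq_ge0.
  rewrite -[leRHS]mul1r -(sum1 _ uW) mulr_suml; apply: ler_sum => k _.
  have [kQ|/vQ->] := boolP (k \in Q); last by rewrite /nsq !mul0r.
  by rewrite ler_wpM2l ?nsq_ge0 //; apply: lmax.
have [l0 wl0] : exists l, 0 < nsq ((v *m V ^t*) 0 l).
  apply/existsP; apply: contraT => /existsPn w0.
  have := sum1 _ uV; rewrite big1 => [/esym/eqP|l _]; first by rewrite oner_eq0.
  by apply/eqP; rewrite eq_le nsq_ge0 andbT leNgt w0.
rewrite -[ltLHS]mul1r -(sum1 _ uV) mulr_suml.
have l0P : l0 \in P.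
  by apply: contraTT wl0 => /vP ->; rewrite /nsq mul0r ltxx.
rewrite (bigD1 l0) //= [ltRHS](bigD1 l0) //=; apply: ltr_leD.
  by rewrite ltr_pM2l //; move: l0P; rewrite inE.
apply: ler_sum => k _; have [kP|/vP->] := boolP (k \in P); last by rewrite /nsq !mul0r.
by rewrite ler_wpM2l ?nsq_ge0 //; move: kP; rewrite inE => /ltW.
Qed.

Lemma mean_powR_dominated (n : nat) (L : 'I_n -> 'M[C]_N) V W mu lam s :
  (0 < n)%N -> (forall j, psd (L j)) -> 0 < s <= 1 ->
  V \is unitarymx -> W \is unitarymx ->
  (forall l, 0 <= mu l) -> (forall l, 0 <= lam l) ->
  (n%:R^-1)%:C *: \sum_j mxpowR (L j) s = spec V mu ->
  (n%:R^-1)%:C *: \sum_j L j = spec W lam ->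
  exists p : {perm 'I_N}, forall l, mu l <= lam (p l) `^ s.
Proof.
move=> n0 pL s01 uV uW mu0 lam0 VE WE; have /andP[s0 s1] := s01.
apply: (@spectra_dominated_perm V W mu lam (fun x => x `^ s)) => //.
  by move=> x y x0 xy; apply: ler_powR2r => //; apply: ltW.
move=> v v1; rewrite -VE -WE !qform_scale !qform_sum !mulr_sumr.
have /fin_all_exists[U US] : forall j, exists u : 'M[C]_N * ('I_N -> R),
    [/\ u.1 \is unitarymx, forall l, 0 <= u.2 l & L j = spec u.1 u.2].
  move=> j.
  by have [U [a [? ? ?]]] := psd_spectral (pL j); exists (U, a).
(* One probability distribution on all pairs (matrix, eigenvector), so that a single use of Jensen
   covers both the mean over [j] and the quadratic forms. *)
pose w (k : 'I_n * 'I_N) := n%:R^-1 * nsq ((v *m (U k.1).1 ^t*) 0 k.2).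
pose t (k : 'I_n * 'I_N) := (U k.1).2 k.2.
have pairE (f : R -> R) : \sum_k w k * f (t k) =
    \sum_j n%:R^-1 * \sum_i nsq ((v *m (U j).1 ^t*) 0 i) * f ((U j).2 i).
  under [RHS]eq_bigr do rewrite mulr_sumr.
  by rewrite pair_big; apply: eq_bigr => -[j i] _; rewrite -mulrA.
have -> : \sum_j n%:R^-1 * qform (mxpowR (L j) s) v = \sum_k w k * t k `^ s.
  rewrite (pairE (fun x => x `^ s)); apply: eq_bigr => j _.
  by have [uU _ ->] := US j; rewrite mxpowR_spec // qform_spec.
have -> : \sum_j n%:R^-1 * qform (L j) v = \sum_k w k * t k.
  rewrite (pairE id); apply: eq_bigr => j _.
  by have [_ _ {1}->] := US j; rewrite qform_spec.
apply: jensen_powR => //.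
- by move=> k; rewrite mulr_ge0 ?nsq_ge0 ?invr_ge0.
- have := pairE (fun=> 1); under eq_bigr do rewrite mulr1.
  move=> ->; rewrite -mulr_sumr.
  rewrite (eq_bigr (fun=> 1)) => [|j _].
    by rewrite sumr_const card_ord mulVf // pnatr_eq0 -lt0n.
  apply: complexI; under eq_bigr do rewrite mulr1.
  by have [uU _ _] := US j; rewrite nsq_row_sum // v1.
- by move=> k; have [_ U0 _] := US k.1; apply: U0.
Qed.

End SpectralInequalities.

(** * Unitarily invariant norms: monotonicity, pinching, majorization *)

Section InvariantNorms.
Variables (R : realType) (N : nat).
Local Notation C := R[i].
Variable nrm : 'M[C]_N -> R.
Hypotheses (hnrm : mxnorm nrm) (hinv : unitarily_invariant nrm).
Implicit Types (V W M X : 'M[C]_N) (d x y : 'I_N -> R).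

Lemma nrmZr (c : R) M : 0 <= c -> nrm (c%:C *: M) = c * nrm M.
Proof. by move=> c0; rewrite (mxnormZ hnrm) ger0_norm ?ler0c. Qed.

Lemma nrm_mull V M : V \is unitarymx -> nrm (V *m M) = nrm M.
Proof.
by move=> uV; have := hinv M uV (unitary_1mx R N); rewrite mulmx1.
Qed.

Lemma nrm_mulr V M : V \is unitarymx -> nrm (M *m V) = nrm M.
Proof.
by move=> uV; have := hinv M (unitary_1mx R N) uV; rewrite mul1mx.
Qed.

Lemma nrm_spec V d : V \is unitarymx -> nrm (spec V d) = nrm (rdiag d).
Proof. by move=> uV; rewrite /spec hinv ?unitary_tmxc. Qed.

Lemma nrm_convex (a b : R) X Y c : 0 <= a -> 0 <= b -> a + b = 1 ->
  nrm X <= c -> nrm Y <= c -> nrm (a%:C *: X + b%:C *: Y) <= c.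
Proof.
move=> a0 b0 ab Xc Yc; apply: le_trans (mxnormD hnrm _ _) _.
rewrite !nrmZr //; apply: (@le_trans _ _ (a * c + b * c)).
  by rewrite lerD // ler_wpM2l.
by rewrite -mulrDl ab mul1r.
Qed.

Lemma perm_mx_unitary (s : {perm 'I_N}) : perm_mx s \is @unitarymx C N N.
Proof.
by apply/unitarymxP; rewrite tr_perm_mx map_perm_mx -perm_mxM mulgV perm_mx1.
Qed.

Lemma nrm_rdiag_perm d (s : {perm 'I_N}) :
  nrm (rdiag (fun l => d (s l))) = nrm (rdiag d).
Proof.
have -> : rdiag (fun l => d (s l)) = row_perm s (col_perm s (rdiag d)).
  by apply/matrixP => i j; rewrite !mxE (inj_eq perm_inj).
by rewrite row_permE col_permE nrm_mull ?nrm_mulr ?perm_mx_unitary.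
Qed.

Definition reflection (l : 'I_N) : 'M[C]_N := diag_mx (\row_k (-1) ^+ (k == l)).

Lemma reflection_unitary l : reflection l \is unitarymx.
Proof.
apply/unitarymxP/matrixP => i j; rewrite mul_diag_mx !mxE.
rewrite [j == i]eq_sym; case: (eqVneq i j) => [->|ij]; last first.
  by rewrite !mulr0n conjC0 mulr0.
by rewrite !mulr1n rmorph_sign -signr_addb addbb.
Qed.

(** Shrinking one coordinate is a convex combination of [y] and its reflection in that coordinate;
    the weights [a] and [b] solve [a + b = 1] and [a - b = x l / y l]. *)
Lemma nrm_rdiag_le_coord x y l : (forall k, k != l -> x k = y k) ->
  0 <= x l <= y l -> nrm (rdiag x) <= nrm (rdiag y).
Proof.
move=> xy /andP[xl0 xly].
have [yl0|yl0] := leP (y l) 0.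
  rewrite (@eq_rdiag _ _ _ y) // => k; have [->|/xy //] := eqVneq k l.
  by apply/eqP; rewrite eq_le xly (le_trans yl0).
pose a := 2^-1 * (1 + x l / y l); pose b := 2^-1 * (1 - x l / y l).
have q0 : 0 <= x l / y l by rewrite divr_ge0 // ltW.
have q1 : x l / y l <= 1 by rewrite ler_pdivrMr // mul1r.
have -> : rdiag x = a%:C *: rdiag y + b%:C *: (reflection l *m rdiag y).
  apply/matrixP => i j; rewrite mul_diag_mx !mxE.
  have [_|ij] := eqVneq i j; last by rewrite !mulr0n !mulr0 addr0.
  rewrite !mulr1n; have [->|il] := eqVneq i l.
    rewrite expr1 mulN1r -rmorphN -!rmorphM -rmorphD /=; congr (_%:C).
    by rewrite /a /b; field; rewrite gt_eqF.
  rewrite expr0 mul1r xy // -!rmorphM -rmorphD /=; congr (_%:C).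
  by rewrite /a /b; field; rewrite gt_eqF.
apply: nrm_convex; rewrite ?nrm_mull ?reflection_unitary //.
- by rewrite /a; lra.
- by rewrite /b; lra.
- by rewrite /a /b; lra.
Qed.

Lemma nrm_rdiag_le x y : (forall l, 0 <= x l <= y l) ->
  nrm (rdiag x) <= nrm (rdiag y).
Proof.
move=> xy; pose z (s : seq 'I_N) l := if l \in s then y l else x l.
have step s : nrm (rdiag x) <= nrm (rdiag (z s)).
  elim: s => [|l s IH]; first exact: lexx.
  apply: le_trans IH _; apply: (@nrm_rdiag_le_coord _ _ l) => [k kl|].
    by rewrite /z in_cons (negbTE kl).
  rewrite /z mem_head; case/andP: (xy l) => x0 xly.
  by case: ifP => _; rewrite ?x0 ?lexx ?andbT // (le_trans x0).
have := step (enum 'I_N).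
by rewrite (@eq_rdiag _ _ (z _) y) // => l; rewrite /z mem_enum.
Qed.

(* Averaging over the sign reflections kills the off-diagonal entries. *)
Lemma nrm_pinching M : nrm (diag_mx (\row_l M l l)) <= nrm M.
Proof.
have half : 2^-1 + 2^-1 = 1 :> R by lra.
(* [M] with the off-diagonal entries in the rows and columns of [s] erased; averaging with the
   conjugate by [reflection l] erases those of [l] too. *)
pose z (s : seq 'I_N) : 'M[C]_N :=
  \matrix_(i, j) if (i == j) || (i \notin s) && (j \notin s) then M i j else 0.
have step s : nrm (z s) <= nrm M.
  elim: s => [|l s IH].
    rewrite (_ : z [::] = M) //; apply/matrixP => i j.
    by rewrite mxE !in_nil orbT.
  have -> : z (l :: s) = (2^-1)%:C *: z s +
      (2^-1)%:C *: (reflection l *m z s *m reflection l).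
    apply/matrixP => i j; rewrite mul_mx_diag mul_diag_mx !mxE !in_cons.
    have h (u : C) : u = (2^-1)%:C * u + (2^-1)%:C * u.
      by rewrite -mulrDl -rmorphD /= half mul1r.
    case: (eqVneq i j) => [->|ij] /=.
      by rewrite mulrAC -signr_addb addbb mul1r.
    case: (eqVneq i l) ij => [->|il] lj /=.
      rewrite eq_sym (negbTE lj) expr0 expr1 mulr1 mulN1r.
      by case: ifP => _; rewrite ?oppr0 ?mulr0 ?addr0 ?mulrN ?subrr.
    case: (eqVneq j l) => [->|jl] /=.
      rewrite andbF expr0 expr1 mul1r mulrN1.
      by case: ifP => _; rewrite ?oppr0 ?mulr0 ?addr0 ?mulrN ?subrr.
    by rewrite expr0 mul1r mulr1.
  apply: nrm_convex; rewrite ?invr_ge0 //.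
  by rewrite nrm_mulr ?nrm_mull ?reflection_unitary.
have := step (enum 'I_N); congr (nrm _ <= _); apply/matrixP => i j.
by rewrite !mxE !mem_enum orbF; case: eqVneq => [->|]; rewrite ?mulr1n ?mulr0n.
Qed.

(** Pinching in the basis [V]. Positivity makes the diagonal real, so [diag_in], which takes real
    parts, loses nothing. *)
Lemma nrm_diag_in_le V M : V \is unitarymx ->
  psd M -> nrm (rdiag (diag_in V M)) <= nrm M.
Proof.
move=> uV pM; have <- : nrm (V *m M *m V ^t*) = nrm M by rewrite hinv ?unitary_tmxc.
apply: le_trans (nrm_pinching _); rewrite le_eqVlt; apply/orP; left.
apply/eqP; congr (nrm (diag_mx _)); apply/rowP => l; rewrite mxE [RHS]mxE.
by rewrite /diag_in RRe_real //; apply: ger0_real; apply: psd_conj_ge0.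
Qed.

Lemma top_sum_nrm_le (r : R) x y : 1 <= r ->
  (forall l, 0 <= x l) -> (forall l, 0 <= y l) ->
  (forall T, upset x T -> \sum_(l in T) x l <= \sum_(l in T) y l) ->
  nrm (rdiag (fun l => x l `^ r)) <= nrm (rdiag (fun l => y l `^ r)).
Proof.
move=> r1 x0 y0; have r0 : 0 <= r by apply: le_trans r1.
apply: (@weak_majorization_le _ _ (fun u => nrm (rdiag (fun l => u l `^ r)))) => //.
  move=> u v uv; apply: nrm_rdiag_le => l; rewrite powR_ge0 /=.
  by case/andP: (uv l) => u0 le; apply: ler_powR2r.
move=> u i j t u0 /andP[t0 t1]; have t1' : 0 <= 1 - t by rewrite subr_ge0.
(* Convexity of the power bounds the transferred vector by [v], a convex combination of two
   diagonals equal up to a permutation, hence of equal norm. *)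
pose v l := (1 - t) * u l `^ r + t * u (tperm i j l) `^ r.
apply: (@le_trans _ _ (nrm (rdiag v))).
  by apply: nrm_rdiag_le => l; rewrite powR_ge0 /= convex_powR2 // subrK.
have -> : rdiag v = (1 - t)%:C *: rdiag (fun l => u l `^ r) +
    t%:C *: rdiag (fun l => u (tperm i j l) `^ r).
  apply/matrixP => k l; rewrite !mxE; case: eqP => _; rewrite ?mulr0n ?mulr0 ?addr0 //.
  by rewrite !mulr1n rmorphD !rmorphM.
apply: nrm_convex => //; first by rewrite subrK.
by rewrite (nrm_rdiag_perm (fun l => u l `^ r)).
Qed.

Variable n : nat.
Variable L : 'I_n -> 'M[C]_N.
Hypothesis pL : forall j, psd (L j).

(** In the eigenbasis of the sum, the diagonal of the sum of powers weakly majorizes the eigenvalues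
    to the power [q]. Majorization with outer exponent 1 and pinching conclude. *)
Lemma nrm_powR_sum_le q : 0 < q <= 1 ->
  nrm (mxpowR (\sum_j L j) q) <= nrm (\sum_j mxpowR (L j) q).
Proof.
move=> q01; have [W [lam [uW lam0 SE]]] := psd_spectral (psd_sum pL).
have pM : psd (\sum_j mxpowR (L j) q) by apply: psd_sum => j; apply: psd_mxpowR.
rewrite SE mxpowR_spec // nrm_spec //; apply: le_trans (nrm_diag_in_le uW pM).
have d0 l : 0 <= diag_in W (\sum_j mxpowR (L j) q) l.
  by rewrite diag_in_qform qform_ge0.
have pow1 u : (forall l, 0 <= u l) ->
    rdiag (fun l => u l `^ 1) = rdiag u :> 'M[C]_N.
  by move=> u0; apply: eq_rdiag => l; rewrite powRr1.
have := @top_sum_nrm_le 1 (fun l => lam l `^ q)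
  (diag_in W (\sum_j mxpowR (L j) q)).
rewrite !pow1 //; last by move=> l; apply: powR_ge0.
apply=> // [l|T upT]; first exact: powR_ge0.
apply: top_sum_powR => //; apply: upset_powR upT => //.
by case/andP: q01.
Qed.

(** The majorization is applied to the powers of the [L j], with exponent [q^-1], in the eigenbasis
    of their sum. The convex power [q] is then restored by [top_sum_nrm_le]. *)
Lemma nrm_sum_powR_le q : 1 <= q ->
  nrm (\sum_j mxpowR (L j) q) <= nrm (mxpowR (\sum_j L j) q).
Proof.
move=> q1; have q0 : 0 < q by apply: lt_le_trans q1.
have pK j : psd (mxpowR (L j) q) by apply: psd_mxpowR.
have [W [lam [uW lam0 SE]]] := psd_spectral (psd_sum pK).
have pS : psd (\sum_j L j) := psd_sum pL.
have LE j : mxpowR (mxpowR (L j) q) q^-1 = L j.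
  by rewrite mxpowR_mul // divff ?gt_eqF // mxpowR1.
have d0 l : 0 <= diag_in W (\sum_j L j) l by rewrite diag_in_qform qform_ge0.
have maj T : upset (fun l => lam l `^ q^-1) T ->
    \sum_(l in T) lam l `^ q^-1 <= \sum_(l in T) diag_in W (\sum_j L j) l.
  move=> upT; have := @top_sum_powR _ _ _ _ W lam q^-1 T pK uW SE lam0.
  rewrite (eq_bigr L) => [|j _]; last exact: LE.
  apply; first by rewrite invr_gt0 q0 invf_le1.
  by apply: upset_powR upT; rewrite ?invr_gt0.
rewrite SE nrm_spec // (@eq_rdiag _ _ lam (fun l => (lam l `^ q^-1) `^ q)); last first.
  by move=> l; rewrite -powRrM mulVf ?gt_eqF // powRr1.
apply: (@le_trans _ _ (nrm (rdiag (fun l => diag_in W (\sum_j L j) l `^ q)))).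
  by apply: top_sum_nrm_le => // l; apply: powR_ge0.
have pSq : psd (mxpowR (\sum_j L j) q) by apply: psd_mxpowR.
apply: le_trans (nrm_diag_in_le uW pSq); apply: nrm_rdiag_le => l.
rewrite powR_ge0 /=; have [V [a [uV a0 ->]]] := psd_spectral pS.
rewrite mxpowR_spec // !diag_in_spec.
set w := fun i => nsq ((W *m V ^t*) l i).
(* A diagonal entry of the sum, to the power [q], is at most the same entry of the power of the
   sum. *)
have := @jensen_powR _ _ w (fun i => a i `^ q) (fun i => nsq_ge0 _)
   (nsq_row_sum1 l uV uW) (fun i => powR_ge0 _ _) q^-1.
under eq_bigr do rewrite powRVK ?gt_eqF //.
rewrite invr_gt0 q0 invf_le1 // q1 => /(_ isT) jen.
have s0 : 0 <= \sum_i w i * a i.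
  by apply: sumr_ge0 => i _; rewrite mulr_ge0 ?nsq_ge0.
apply: le_trans (ler_powR2r (ltW q0) s0 jen) _.
rewrite -powRrM mulVf ?gt_eqF // powRr1 //.
by apply: sumr_ge0 => i _; rewrite mulr_ge0 ?nsq_ge0 ?powR_ge0.
Qed.

End InvariantNorms.

(** * The factor [n ^ (q - 1)], by comparison of arithmetic means *)

Section Means.
Variables (R : realType) (N : nat).
Local Notation C := R[i].
Variable nrm : 'M[C]_N -> R.
Hypotheses (hnrm : mxnorm nrm) (hinv : unitarily_invariant nrm).
Variables (n : nat) (L : 'I_n -> 'M[C]_N).
Hypotheses (n0 : (0 < n)%N) (pL : forall j, psd (L j)).

Lemma spec_scale (c : R) (V : 'M[C]_N) d :
  c%:C *: spec V d = spec V (fun l => c * d l).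
Proof.
have cd : rdiag (fun l => c * d l) = c%:C *: rdiag d.
  by apply/matrixP => i j; rewrite !mxE rmorphM mulrnAr.
by rewrite /spec cd -scalemxAr -scalemxAl.
Qed.

Lemma nrm_mean_spec X V mu : V \is unitarymx ->
  (n%:R^-1)%:C *: X = spec V mu -> nrm X = n%:R * nrm (rdiag mu).
Proof.
move=> uV XE; rewrite -(nrm_spec hinv mu uV) -XE (nrmZr hnrm) ?invr_ge0 //.
by rewrite mulrA mulfV ?mul1r // pnatr_eq0 -lt0n.
Qed.

Lemma nrm_mxpowR_mean_spec X V mu q : V \is unitarymx -> (forall l, 0 <= mu l) ->
  (n%:R^-1)%:C *: X = spec V mu ->
  nrm (mxpowR X q) = n%:R `^ q * nrm (rdiag (fun l => mu l `^ q)).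
Proof.
move=> uV mu0 XE.
have -> : X = spec V (fun l => n%:R * mu l).
  rewrite -spec_scale -XE scalerA -rmorphM /= mulfV ?scale1r //.
  by rewrite pnatr_eq0 -lt0n.
have -> := mxpowR_spec (fun l => n%:R * mu l) q uV.
rewrite (@eq_spec _ _ _ _ (fun l => n%:R `^ q * mu l `^ q)) => [|l].
  by rewrite -spec_scale (nrmZr hnrm) ?powR_ge0 // nrm_spec.
by rewrite powRM.
Qed.

Lemma psd_mean (M : 'I_n -> 'M[C]_N) :
  (forall j, psd (M j)) -> psd ((n%:R^-1)%:C *: \sum_j M j).
Proof. by move=> pM; apply: psd_scale; rewrite ?invr_ge0 //; apply: psd_sum. Qed.

Lemma nrm_sum_powR_le_mean q : 0 < q <= 1 ->
  nrm (\sum_j mxpowR (L j) q) <= n%:R `^ (1 - q) * nrm (mxpowR (\sum_j L j) q).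
Proof.
move=> q01; have pLq j : psd (mxpowR (L j) q) by apply: psd_mxpowR.
have [V [mu [uV mu0 VE]]] := psd_spectral (psd_mean pLq).
have [W [lam [uW lam0 WE]]] := psd_spectral (psd_mean pL).
have [s le] := mean_powR_dominated n0 pL q01 uV uW mu0 lam0 VE WE.
rewrite (nrm_mean_spec uV VE) (nrm_mxpowR_mean_spec q uW lam0 WE) mulrA.
(* The factor [n] from the mean on the left equals [n ^ (1 - q)] times the [n ^ q] produced on the
   right by the power of [n] times a mean. *)
rewrite -powRD; last by rewrite pnatr_eq0 -lt0n n0 implybT.
rewrite subrK powRr1 // ler_wpM2l //.
rewrite -(nrm_rdiag_perm hinv (fun l => lam l `^ q) s).
by apply: (nrm_rdiag_le hnrm hinv) => l; rewrite mu0 le.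
Qed.

Lemma nrm_powR_sum_le_mean q : 1 <= q ->
  nrm (mxpowR (\sum_j L j) q) <= n%:R `^ (q - 1) * nrm (\sum_j mxpowR (L j) q).
Proof.
move=> q1; have q0 : 0 < q by apply: lt_le_trans q1.
have pLq j : psd (mxpowR (L j) q) by apply: psd_mxpowR.
have LE j : mxpowR (mxpowR (L j) q) q^-1 = L j.
  by rewrite (mxpowR_mul _ _ (pL j)) divff ?gt_eqF // mxpowR1.
have [V [mu [uV mu0 VE]]] := psd_spectral (psd_mean pL).
have [W [lam [uW lam0 WE]]] := psd_spectral (psd_mean pLq).
have VE' : (n%:R^-1)%:C *: \sum_j mxpowR (mxpowR (L j) q) q^-1 = spec V mu.
  by rewrite (eq_bigr L) => [|j _]; [exact: VE|exact: LE].
have q'01 : 0 < q^-1 <= 1 by rewrite invr_gt0 q0 invf_le1.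
(* With the powers of the [L j] as data, this bounds [mu] by a permuted [lam ^ q^-1]; raising to the
   power [q] gives back [lam]. *)
have [s le] := mean_powR_dominated n0 pLq q'01 uV uW mu0 lam0 VE' WE.
rewrite (nrm_mean_spec uW WE) (nrm_mxpowR_mean_spec q uV mu0 VE) mulrA.
rewrite [_ * n%:R]mulrC mulr_powRB1 // ler_wpM2l ?powR_ge0 //.
rewrite -(nrm_rdiag_perm hinv lam s).
apply: (nrm_rdiag_le hnrm hinv) => l; rewrite powR_ge0 /=.
apply: le_trans (ler_powR2r (ltW q0) (mu0 l) (le l)) _.
by rewrite -powRrM mulVf ?gt_eqF // powRr1.
Qed.

End Means.

(** * The quadratic symmetric modulus under an isometry *)

Section QuadraticModulus.
Variables (R : realType) (N : nat).
Local Notation C := R[i].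

Definition qsymsq (Z : 'M[C]_N) : 'M[C]_N := 2^-1 *: (Z ^t* *m Z + Z *m Z ^t*).

Lemma psd_qsymsq Z : psd (qsymsq Z).
Proof.
have -> : qsymsq Z = (2^-1)%:C *: (Z ^t* *m Z + Z *m Z ^t*).
  by rewrite /qsymsq fmorphV rmorph_nat.
apply: psd_scale; rewrite ?invr_ge0 //; apply: psdD; first exact: psd_gram.
by have := psd_gram (Z ^t*); rewrite trmxCK.
Qed.

Lemma mxpowR_qsymmod Z p : mxpowR (qsymmod Z) p = mxpowR (qsymsq Z) (p / 2).
Proof. by rewrite /qsymmod (mxpowR_mul _ _ (psd_qsymsq Z)) mulrC. Qed.

(** Expanding each product of [B i] with its adjoint gives a double sum over [j] and [k]; summing
    its coefficients over [i] gives the entries of [U^* U = 1], so only the terms [j = k]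
    survive. *)
Lemma isometry_sum_qsymsq (m n : nat) (A : 'I_n -> 'M[C]_N)
    (B : 'I_m -> 'M[C]_N) (U : 'M[C]_(m, n)) :
  isometrymx U -> (forall i, B i = \sum_(j < n) U i j *: A j) ->
  \sum_i qsymsq (B i) = \sum_j qsymsq (A j).
Proof.
move=> hU hB; rewrite -!scaler_sumr; congr (_ *: _); rewrite !big_split /=.
have orth j k : \sum_i (U i j)^*%R * U i k = (j == k)%:R.
  have := congr1 (fun M : 'M[C]_n => M j k) hU; rewrite !mxE => <-.
  by apply: eq_bigr => i _; rewrite !mxE.
have collapse (F : 'I_n -> 'I_n -> 'M[C]_N) :
    \sum_i \sum_j \sum_k ((U i j)^*%R * U i k) *: F j k = \sum_j F j j.
  rewrite exchange_big; apply: eq_bigr => j _; rewrite exchange_big /=.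
  rewrite (bigD1 j) //= -scaler_suml orth eqxx scale1r big1 ?addr0 // => k kj.
  by rewrite -scaler_suml orth eq_sym (negbTE kj) scale0r.
congr (_ + _).
  rewrite -(collapse (fun j k => A j ^t* *m A k)); apply: eq_bigr => i _.
  rewrite hB tmxc_sum mulmx_suml; apply: eq_bigr => j _.
  rewrite mulmx_sumr; apply: eq_bigr => k _.
  by rewrite tmxcZ -scalemxAl -scalemxAr scalerA.
(* The adjoint factor is expanded first, so that [j] again carries the conjugate and the same
   [collapse] applies. *)
rewrite -(collapse (fun j k => A k *m A j ^t*)); apply: eq_bigr => i _.
rewrite hB tmxc_sum mulmx_sumr; apply: eq_bigr => j _.
rewrite mulmx_suml; apply: eq_bigr => k _.
by rewrite tmxcZ -scalemxAl -scalemxAr scalerA mulrC.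
Qed.

End QuadraticModulus.

Theorem theorem1p21 (R : realType) (N m n : nat)
    (hN : (0 < N)%N) (hm : (0 < m)%N) (hn : (0 < n)%N)
    (A : 'I_n -> 'M[R[i]]_N) (B : 'I_m -> 'M[R[i]]_N)
    (U : 'M[R[i]]_(m, n)) (hU : isometrymx U)
    (hB : forall i : 'I_m, B i = \sum_(j < n) U i j *: A j)
    (nrm : 'M[R[i]]_N -> R) (hnrm : mxnorm nrm)
    (hinv : unitarily_invariant nrm) (p : R) :
  (2 <= p ->
     m%:R `^ (1 - p / 2) * nrm (\sum_(j < n) mxpowR (qsymmod (A j)) p)
       <= nrm (\sum_(i < m) mxpowR (qsymmod (B i)) p)
     /\ nrm (\sum_(i < m) mxpowR (qsymmod (B i)) p)
       <= n%:R `^ (p / 2 - 1) * nrm (\sum_(j < n) mxpowR (qsymmod (A j)) p))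
  /\
  (0 < p -> p <= 2 ->
     nrm (\sum_(i < m) mxpowR (qsymmod (B i)) p)
       <= m%:R `^ (1 - p / 2) * nrm (\sum_(j < n) mxpowR (qsymmod (A j)) p)
     /\ n%:R `^ (p / 2 - 1) * nrm (\sum_(j < n) mxpowR (qsymmod (A j)) p)
       <= nrm (\sum_(i < m) mxpowR (qsymmod (B i)) p)).
Proof.
have SE := isometry_sum_qsymsq hU hB.
have pA j := psd_qsymsq (A j); have pB i := psd_qsymsq (B i).
have powA r : \sum_(j < n) mxpowR (qsymmod (A j)) r =
    \sum_j mxpowR (qsymsq (A j)) (r / 2).
  by apply: eq_bigr => j _; rewrite mxpowR_qsymmod.
have powB r : \sum_(i < m) mxpowR (qsymmod (B i)) r =
    \sum_i mxpowR (qsymsq (B i)) (r / 2).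
  by apply: eq_bigr => i _; rewrite mxpowR_qsymmod.
have cancel k x y r : (0 < k)%N ->
    (k%:R : R) `^ (1 - r) * x <= y <-> x <= k%:R `^ (r - 1) * y.
  move=> k0; have kr : 0 < (k%:R : R) by rewrite ltr0n.
  by rewrite -(opprB r) powRN mulrC ler_pdivrMr ?powR_gt0 // mulrC.
have cancel' k x y r : (0 < k)%N ->
    x <= (k%:R : R) `^ (1 - r) * y <-> k%:R `^ (r - 1) * x <= y.
  move=> k0; have kr : 0 < (k%:R : R) by rewrite ltr0n.
  by rewrite -(opprB r) powRN [_^-1 * y]mulrC ler_pdivlMr ?powR_gt0 // mulrC.
rewrite powA powB; split=> [p2|p0 p2].
  have q1 : 1 <= p / 2 by rewrite ler_pdivlMr // mul1r.
  split.
    (* The power of the common sum links both families: the [A j] enter without a constant, and the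
       [m] matrices [B i] supply the power of [m]. For the second inequality the roles are
       exchanged. *)
    apply/cancel => //; apply: le_trans (nrm_sum_powR_le hnrm hinv pA q1) _.
    rewrite -SE; exact: nrm_powR_sum_le_mean.
  apply: le_trans (nrm_sum_powR_le hnrm hinv pB q1) _.
  rewrite SE; exact: nrm_powR_sum_le_mean.
have q01 : 0 < p / 2 <= 1 by rewrite divr_gt0 //= ler_pdivrMr // mul1r.
split.
  (* For [q <= 1] the constant comes from the family on the smaller side: [m] from the [B i] here,
     [n] from the [A j] below. *)
  apply: le_trans (nrm_sum_powR_le_mean hnrm hinv hm pB q01) _.
  rewrite SE ler_wpM2l ?powR_ge0 //; exact: nrm_powR_sum_le.
apply/cancel' => //; apply: le_trans (nrm_sum_powR_le_mean hnrm hinv hn pA q01) _.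
rewrite -SE ler_wpM2l ?powR_ge0 //; exact: nrm_powR_sum_le.
Qed.
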